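(* For every positive integer $r$ there is a constant $C_r$ (depending only on $r$) such that for all positive integers $n$, $F_r(n)\ge \frac{n}{r^2+1}-C_r$.
   Context: For a positive integer $n$, $[n]=\{1,\dots,n\}$ and $[n]^{(2)}$ is the set of $2$-element subsets of $[n]$. $\mathcal{C}_{n;r}$ is the set of all maps $c:[n]^{(2)}\to[r]$. For such $c$, a twin of size $\ell$ is a pair of disjoint sets $I=\{i_1<\dots<i_\ell\}$, $J=\{j_1<\dots<j_\ell\}\subset[n]$ with $c(\{i_t,i_{t+1}\})=c(\{j_t,j_{t+1}\})$ for all $t=1,\dots,\ell-1$; $f(c)$ is the maximum size of a twin of $c$, and $F_r(n)=\min_{c\in\mathcal{C}_{n;r}}f(c)$. *)

(* Defs.v *)
From mathcomp Require Import all_boot all_order all_algebra.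
Set Implicit Arguments.
Unset Strict Implicit.
Unset Printing Implicit Defensive.

(* The vertex set [n] = {1, ..., n} is represented by 'I_n = {0, ..., n-1}. *)
Definition edge (n : nat) : finType := {e : {set 'I_n} | #|e| == 2}.

Definition colouring (n r : nat) : finType := {ffun edge n -> 'I_r}.

(* Equal to [Some (c {i, j})] when [i != j], and to [None] when [i = j]; below
   it is only applied to distinct vertices. *)
Definition colour (n r : nat) (c : colouring n r) (i j : 'I_n) : option 'I_r :=
  omap c (insub [set i; j]).

(* For s = [:: i_1; ...; i_l], the sequence of the c {i_t, i_(t+1)}, 1 <= t < l. *)
Definition colour_seq (n r : nat) (c : colouring n r) (s : seq 'I_n) :
    seq (option 'I_r) :=
  if s is i :: s' then pairmap (colour c) i s' else [::].

(* [enum I] lists the elements of [I : {set 'I_n}] in increasing order. *)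
Definition twin (n r : nat) (c : colouring n r) (I J : {set 'I_n}) : bool :=
  [&& [disjoint I & J], #|I| == #|J|
    & colour_seq c (enum I) == colour_seq c (enum J)].

Definition max_twin (n r : nat) (c : colouring n r) : nat :=
  \max_(IJ : {set 'I_n} * {set 'I_n} | twin c IJ.1 IJ.2) #|IJ.1|.

(* Since [max_twin c <= n] always holds, and there is a colouring when [0 < r],
   the default value [n] does not affect the minimum. *)
Definition min_max_twin (r n : nat) : nat :=
  \big[Order.min/n]_(c : colouring n r) max_twin c.

(* Main.v *)
(** Cut the vertices into blocks of [r ^ 2 + 1] consecutive ones and treat the
    blocks from right to left, keeping a set [K] of [r + 1] vertices of the
    current block any two of which start the two halves of a twin with one
    vertex of each half in every block treated so far.  Each vertex [v] of the
    preceding block sends two edges of the same colour to [K]; call such a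
    colour repeated at [v].  Some colour is repeated at [r + 1] vertices of that
    block.  If it is repeated at both [v] and [w], the edges of that colour from
    [v] to [K] and from [w] to [K] can be chosen with different ends, so that the
    twin extends to [v] and [w]. *)
Require Import Defs.
From mathcomp Require Import all_boot all_order all_algebra.
From mathcomp Require Import zify.
Import Order.TTheory GRing.Theory Num.Theory.
Local Open Scope ring_scope.

(** Double counting of the related pairs: each [x] lies in at least one, and if every [d] were
    related to at most [k] elements there would be at most [#|D| * k] pairs. *)
Lemma pigeonhole_rel (T S : finType) (A : {set T}) (D : {set S})
    (e : T -> S -> bool) (k : nat) :
  (forall x, x \in A -> exists2 d, d \in D & e x d) -> (#|D| * k < #|A|)%N ->
  exists2 d, d \in D & (k < #|[set x in A | e x d]|)%N.
Proof.
move=> eA ltDA; apply/exists_inP; apply: contraLR ltDA.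
rewrite negb_exists_in -leqNgt => /forall_inP small.
rewrite -sum1_card.
apply: (@leq_trans (\sum_(x in A) \sum_(d in D) e x d)).
  apply: leq_sum => x /eA[d dD exd].
  by rewrite (bigD1 d) //= exd.
rewrite exchange_big /= -sum_nat_const.
apply: leq_sum => d dD; have := small d dD; rewrite -leqNgt.
apply: leq_trans; rewrite -sum1_card [leqRHS](eq_bigl (fun x => (x \in A) && e x d)).
  by rewrite big_mkcondr /=; apply: leq_sum => x _; case: (e x d).
by move=> x; rewrite inE.
Qed.

(** Pigeonhole twice: as [#|D| < #|K|], each [v] in [A] takes some value at two points of [K]; as
    [#|D| ^ 2 < #|A|], one value is repeated in this way at more than [#|D|] elements. *)
Lemma linked_subset (T S : finType) (A K : {set T}) (D : {set S})
    (f : T -> T -> S) :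
  (forall v x, v \in A -> x \in K -> f v x \in D) ->
  (#|D| < #|K|)%N -> (#|D| ^ 2 < #|A|)%N ->
  exists L : {set T}, [/\ L \subset A, (#|D| < #|L|)%N &
    forall v w, v \in L -> w \in L ->
      exists x y, [/\ x \in K, y \in K, x != y & f v x = f w y]].
Proof.
move=> fD ltDK ltDA.
have [v vA|d dD ltDL] := @pigeonhole_rel T S A D
  (fun v d => 1 < #|[set x in K | f v x == d]|)%N #|D| _ ltDA.
  apply: pigeonhole_rel; last by rewrite muln1.
  by move=> x xK; exists (f v x); rewrite ?fD.
exists [set v in A | (1 < #|[set x in K | f v x == d]|)%N]; split => //.
  by apply/subsetP => v; rewrite inE => /andP[].
move=> v w; rewrite !inE => /andP[_ /card_gt1P[x [_ [xd _ _]]]].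
move=> /andP[_ /card_gt1P[y1 [y2 [y1d y2d neq_y]]]].
move: xd y1d y2d; rewrite !inE.
move=> /andP[xK /eqP fx] /andP[y1K /eqP fy1] /andP[y2K /eqP fy2].
(* Of the two points where [f w] equals [d], at least one differs from [x]. *)
have [eq_x1|neq_x1] := eqVneq x y1.
  by exists x, y2; rewrite eq_x1 in fx *; split; rewrite // fx fy2.
by exists x, y1; split; rewrite // fx fy1.
Qed.

Lemma card_ord_interval (n p m : nat) :
  (p + m <= n)%N -> #|[set i : 'I_n | (p <= i < p + m)%N]| = m.
Proof.
move=> lepmn; rewrite -sum1dep_card.
rewrite -(big_mkord (fun i => p <= i < p + m)%N (fun=> 1%N)).
rewrite (eq_bigl (fun i => (p <= i)%N && (i < p + m)%N)) //.
rewrite -(big_nat_widen 0 (p + m) n (fun i => p <= i)%N) //.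
by rewrite -(big_nat_widenl p 0 _ predT) // sum_nat_const_nat addKn muln1.
Qed.

Lemma enum_sorted_set (n : nat) (s : seq 'I_n) :
  sorted (fun i j : 'I_n => (i < j)%N) s -> enum [set x in s] = s.
Proof.
move=> sorted_s; apply: (@irr_sorted_eq _ (fun i j : 'I_n => (i < j)%N)) => //.
- by move=> y x z; apply: ltn_trans.
- by move=> x; apply: ltnn.
- rewrite {1}/enum_mem.
  apply: sorted_filter; first by move=> y x z; apply: ltn_trans.
  by have := iota_ltn_sorted 0 n; rewrite -val_enum_ord sorted_map enumT.
by move=> x; rewrite mem_enum inE.
Qed.

(** [None] is left out, so that [r] values are counted and not the [r + 1] of the option type. *)
Definition colours (r : nat) : {set option 'I_r} := Some @: setT.

Lemma card_colours (r : nat) : #|colours r| = r.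
Proof. by rewrite card_imset ?cardsT ?card_ord // => i j []. Qed.

Lemma colour_Some (n r : nat) (c : colouring n r) (i j : 'I_n) :
  i != j -> colour c i j \in colours r.
Proof.
move=> neq_ij; rewrite /colour insubT ?cards2 ?neq_ij // => ij2 /=.
exact: imset_f.
Qed.

(** Sequences instead of sets: a twin then grows to the left by consing a vertex onto each half. *)
Definition twin_seqs {n r : nat} (c : colouring n r) (s t : seq 'I_n) : bool :=
  [&& uniq (s ++ t), size s == size t,
      sorted (fun i j : 'I_n => (i < j)%N) s,
      sorted (fun i j : 'I_n => (i < j)%N) t &
      colour_seq c s == colour_seq c t].

Lemma twin_seqs_max_twin (n r : nat) (c : colouring n r) (s t : seq 'I_n) :
  twin_seqs c s t -> (size s <= max_twin c)%N.
Proof.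
case/and5P; rewrite cat_uniq => /and3P[us dst ut] /eqP est sorted_s sorted_t.
move=> /eqP ecol.
have -> : size s = #|[set x in s]| by rewrite cardE enum_sorted_set.
apply: (bigop.bigmax_sup ([set x in s], [set x in t])) => //=.
rewrite /twin !cardE !enum_sorted_set // est ecol !eqxx !andbT.
rewrite disjoint_sym disjoint_subset; apply/subsetP => x; rewrite !inE => xt.
by apply: contra dst => xs; apply/hasP; exists x.
Qed.

(** The offset [p] varies because the induction adds each new block in front: its hypothesis is used
    at [p + (r ^ 2).+1]. *)
Lemma twin_clique (n r : nat) (c : colouring n r) (l p : nat) :
  (p + l.+1 * (r ^ 2).+1 <= n)%N ->
  exists K : {set 'I_n}, [/\ (r < #|K|)%N, (forall x, x \in K -> (p <= x)%N) &
    forall x y, x \in K -> y \in K -> x != y ->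
    exists s t, [/\ size s = l, all (fun z : 'I_n => (p <= z)%N) (s ++ t) &
      twin_seqs c (x :: s) (y :: t)]].
Proof.
elim: l p => [|l IHl] p.
  rewrite mul1n => le_n.
  exists [set i : 'I_n | (p <= i < p + (r ^ 2).+1)%N]; split.
  - by rewrite card_ord_interval //; nia.
  - by move=> x; rewrite inE => /andP[].
  by move=> x y _ _ neq_xy; exists [::], [::]; rewrite /twin_seqs /= inE neq_xy.
rewrite mulSn addnA => le_n; have [K [ltK geK linkK]] := IHl _ le_n.
set A := [set i : 'I_n | (p <= i < p + (r ^ 2).+1)%N].
have [v x vA xK||| L [subL ltL linkL]] :=
    @linked_subset _ _ A K (colours r) (colour c).
- apply: colour_Some; apply: contraTneq vA => ->.
  by rewrite inE negb_and -(leqNgt _ x) geK // orbT.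
- by rewrite card_colours.
- by rewrite card_colours card_ord_interval //; lia.
rewrite card_colours in ltL.
have inA v : v \in L -> (p <= v < p + (r ^ 2).+1)%N.
  by move/(subsetP subL); rewrite inE.
exists L; split=> // [v /inA/andP[]//|v w vL wL neq_vw].
have [x [y [xK yK neq_xy ecol]]] := linkL v w vL wL.
have [s [t [size_s all_st /and5P[uniq_st size_st sorted_s sorted_t col_st]]]] :=
  linkK x y xK yK neq_xy.
have /andP[le_pv lt_v] := inA v vL; have /andP[le_pw lt_w] := inA w wL.
have ge_all : all (fun z : 'I_n => (p + (r ^ 2).+1 <= z)%N) ((x :: s) ++ y :: t).
  by move: all_st; rewrite /= !all_cat /= !geK.
(* The new block ends before the earlier twin begins, so [v] and [w] are new vertices. *)
have notin u : (u < p + (r ^ 2).+1)%N -> u \notin map val ((x :: s) ++ y :: t).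
  move=> lt_u; apply/negP => /mapP[z /(allP ge_all) + eq_u].
  by rewrite leqNgt -[val z]eq_u lt_u.
exists (x :: s), (y :: t); split; first by rewrite /= size_s.
  by apply: sub_all ge_all => z; apply: leq_trans; apply: leq_addr.
apply/and5P; split.
- rewrite -[X in uniq X]/((v :: x :: s) ++ [:: w] ++ y :: t) uniq_catCA.
  rewrite -[X in uniq X]/[:: w, v & (x :: s) ++ y :: t] 2!cons_uniq uniq_st.
  have := notin _ lt_v; have := notin _ lt_w.
  rewrite !(mem_map val_inj) => wN vN.
  by rewrite inE negb_or eq_sym neq_vw wN vN.
- by rewrite /= eqSS.
- by rewrite /= (leq_trans lt_v) ?geK.
- by rewrite /= (leq_trans lt_w) ?geK.
- by rewrite /= eqseq_cons ecol eqxx.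
Qed.

Theorem theorem1 (R : realFieldType) (r : nat) (hr : (0 < r)%N) :
  exists C : R, forall n : nat, (0 < n)%N ->
    n%:R / (r%:R ^+ 2 + 1) - C <= (min_max_twin r n)%:R.
Proof.
(* The constant 1 absorbs the rounding down in [n %/ (r ^ 2).+1]. *)
exists 1 => n _.
have le_min : (n %/ (r ^ 2).+1 <= min_max_twin r n)%N.
  rewrite -leEnat /min_max_twin; apply/bigmin_geP; split; rewrite ?leEnat.
    (* The bound for the default value [n] of the minimum. *)
    exact: leq_div.
  move=> c _; case def_k: (n %/ _)%N => [//|l].
  have le_n : (0 + l.+1 * (r ^ 2).+1 <= n)%N by rewrite -def_k leq_trunc_div.
  have [K [ltK _ linkK]] := @twin_clique n r c l 0 le_n.
  (* Since [0 < r], more than [r] vertices include two distinct ones. *)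
  have /card_gt1P[x [y [xK yK neq_xy]]] := leq_ltn_trans hr ltK.
  by have [s [t [<- _ /twin_seqs_max_twin]]] := linkK x y xK yK neq_xy.
have m_gt0 : 0 < r%:R ^+ 2 + 1 :> R by rewrite ltr_wpDl ?exprn_ge0.
rewrite lerBlDr ler_pdivrMr // -natrX !natr1 -natrM ler_nat.
apply: ltnW; apply: leq_trans (ltn_ceil n (ltn0Sn (r ^ 2))) _.
by rewrite leq_mul2r ltnS le_min.
Qed.
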